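(* Let $i\ge 1$ be an integer and let $G$ be a group (not necessarily finite) such that the index $|\gamma_{i+1}(G):\gamma_{i+1}(G)\cap Z_i(G)|$ is finite. Then the index $|G:Z_{2i}(G)|$ is finite.
   Context: For a group $G$, $\gamma_k(G)$ denotes the $k$-th term of the lower central series: $\gamma_1(G)=G$ and $\gamma_{k+1}(G)=[\gamma_k(G),G]$ for $k\ge 1$. $Z_k(G)$ denotes the $k$-th term of the upper central series: $Z_0(G)=1$ and $Z_{k+1}(G)/Z_k(G)=Z(G/Z_k(G))$ for $k\ge 0$; in particular $Z_1(G)=Z(G)$ is the center. *)

(* Defs.v *)
From mathcomp Require Import all_boot.
From mathcomp Require Import boolp classical_sets functions cardinality.

Set Implicit Arguments.
Unset Strict Implicit.
Unset Printing Implicit Defensive.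

Local Open Scope classical_set_scope.
Local Open Scope group_scope.

(* Subgroups of the possibly infinite group G are classical sets, i.e., terms
   of type set G. The eqType and choiceType structures bundled in groupType
   are no restriction: by the classical axioms, every type has them. *)

Definition is_subgroup (G : groupType) (H : set G) : Prop :=
  group_closed [in H].

Definition generated (G : groupType) (A : set G) : set G :=
  smallest (@is_subgroup G) A.

Definition commutator_subgroup (G : groupType) (H K : set G) : set G :=
  generated [set [~ h, k] | h in H & k in K].

Definition left_coset (G : groupType) (H : set G) (x : G) : set G :=
  [set x * h | h in H].

(* The set { x H | x in K }, intended for a subgroup H of K. *)
Definition left_cosets (G : groupType) (K H : set G) : set (set G) :=
  [set left_coset H x | x in K].

(* |K : H| is finite. *)
Definition finite_index (G : groupType) (K H : set G) : Prop :=
  finite_set (left_cosets K H).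

Definition set_product (G : groupType) (A B : set G) : set G :=
  [set a * b | a in A & b in B].

(* Z(G / N), as a set of cosets: for N normal in G, the product of two elements
   of the quotient group G / N is their elementwise product. *)
Definition center_quotient (G : groupType) (N : set G) : set (set G) :=
  [set C | left_cosets setT N C /\
     forall D, left_cosets setT N D -> set_product C D = set_product D C].

(* lower_central G k is gamma_k(G) for k >= 1; the value at k = 0, which is
   not part of the series, is G. *)
Definition lower_central (G : groupType) (k : nat) : set G :=
  iter k.-1 (fun H => commutator_subgroup H setT) setT.

(* Z_{k+1}(G) is the preimage of Z(G / Z_k(G)) by the projection
   x |-> x Z_k(G). *)
Definition upper_central (G : groupType) (k : nat) : set G :=
  iter k (fun N => left_coset N @^-1` center_quotient N) [set 1].

Arguments lower_central G k : clear implicits.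
Arguments upper_central G k : clear implicits.

(* Main.v *)
(* Write Z_r for Z_r(G), and call a subgroup finite modulo Z_r when its image in
   G / Z_r is finite.  By downward induction on k, for k + m > n + 1 and y in
   gamma_m the commutators [e, y] with e in gamma_k take finitely many values
   modulo Z_(r-1) whenever gamma_(n+1) is finite modulo Z_r.  Hence elements of
   gamma_(n+1) have finitely many conjugates modulo Z_(r-1), and Schur's argument
   shows that gamma_(n+2) is finite modulo Z_(r-1).  So gamma_(i+1+k) is finite
   modulo Z_(i-k) for k <= i, and there is a normal subgroup C of finite index
   with [gamma_(i+1+k), C] <= Z_(i-1-k) for all k < i.  Let M_j = [C, G, .., G]
   with j copies of G.  The three subgroups lemma gives
   [M_a, M_b] <= Z_(2i-1-a-b).  Since M_i <= gamma_(i+1) is finite modulo Z_i, it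
   follows by downward induction that M_j is finite modulo Z_(2i-j): an element c
   of M_j lies in Z_(2i-j) as soon as [c, t] is in Z_(2i-j-1) for the finitely
   many t of a transversal of C.  The case j = 0 is the theorem. *)
Require Import Defs.
From mathcomp Require Import all_boot zify.
From mathcomp Require Import boolp classical_sets functions cardinality.

Set Implicit Arguments.
Unset Strict Implicit.
Unset Printing Implicit Defensive.

Local Open Scope group_scope.
Local Open Scope classical_set_scope.

Implicit Types G : groupType.

(** Meant for identities valid in every group: conjugates and commutators are expanded and adjacent
    inverses cancelled in left-associated words. *)
Ltac group_simp :=
  rewrite ?(conjgE, commgEl, invgM, invgK, mulgA, mulgK, mulgVK, mulVg, mulgV,
            mul1g, mulg1, invg1).

(** * Subgroups, normal subgroups and congruence modulo a subgroup *)

Lemma subgroup1 G (H : set G) : is_subgroup H -> H 1.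
Proof. by case; rewrite inE. Qed.

Lemma subgroupF G (H : set G) x y : is_subgroup H -> H x -> H y -> H (x / y).
Proof. by case=> _ HF Hx Hy; have := HF x y; rewrite !inE; apply. Qed.

Lemma subgroupV G (H : set G) x : is_subgroup H -> H x -> H x^-1.
Proof.
by move=> sgH Hx; rewrite -div1g; apply: subgroupF => //; apply: subgroup1.
Qed.

Lemma subgroupM G (H : set G) x y : is_subgroup H -> H x -> H y -> H (x * y).
Proof.
move=> sgH Hx Hy; rewrite -[y]invgK; apply: subgroupF => //.
exact: subgroupV.
Qed.

Lemma is_subgroupP G (H : set G) :
  H 1 -> (forall x y, H x -> H y -> H (x / y)) -> is_subgroup H.
Proof. by move=> H1 HF; split=> [|x y]; rewrite !inE //; apply: HF. Qed.

Definition normal_subgroup G (N : set G) : Prop :=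
  is_subgroup N /\ forall x g, N x -> N (x ^ g).

Lemma normalT G : normal_subgroup [set: G].
Proof. by split => //; apply: is_subgroupP. Qed.

Lemma normal_trivial G : normal_subgroup [set (1 : G)].
Proof.
split; last by move=> x g /= ->; rewrite conj1g.
by apply: is_subgroupP => // x y /= -> ->; rewrite mulgV.
Qed.

Lemma normalI G (N N' : set G) :
  normal_subgroup N -> normal_subgroup N' -> normal_subgroup (N `&` N').
Proof.
move=> [sN JN] [sN' JN']; split; last by move=> x g [??]; split; auto.
apply: is_subgroupP; first by split; apply: subgroup1.
by move=> x y [??] [??]; split; apply: subgroupF.
Qed.

Definition eqmod G (N : set G) (x y : G) : Prop := N (x^-1 * y).

Lemma eqmod_refl G (N : set G) x : is_subgroup N -> eqmod N x x.
Proof. by move=> sN; rewrite /eqmod mulVg; apply: subgroup1. Qed.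

Lemma eqmod_sym G (N : set G) x y : is_subgroup N -> eqmod N x y -> eqmod N y x.
Proof.
by move=> sN /(subgroupV sN); rewrite /eqmod invgM invgK.
Qed.

Lemma eqmod_trans G (N : set G) y x z :
  is_subgroup N -> eqmod N x y -> eqmod N y z -> eqmod N x z.
Proof.
move=> sN Nxy Nyz; have := subgroupM sN Nxy Nyz.
by rewrite /eqmod -mulgA mulVKg.
Qed.

Lemma eqmodM G (N : set G) x x' y y' : normal_subgroup N ->
  eqmod N x x' -> eqmod N y y' -> eqmod N (x * y) (x' * y').
Proof.
move=> [sN JN] Nx Ny; have := subgroupM sN (JN _ y Nx) Ny.
by rewrite /eqmod; group_simp.
Qed.

Lemma eqmodV G (N : set G) x x' : normal_subgroup N ->
  eqmod N x x' -> eqmod N x^-1 x'^-1.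
Proof.
move=> [sN JN] /(eqmod_sym sN) Nx; have := JN _ x^-1 Nx.
by rewrite /eqmod; group_simp.
Qed.

Lemma eqmodJ G (N : set G) x x' y y' : normal_subgroup N ->
  eqmod N x x' -> eqmod N y y' -> eqmod N (x ^ y) (x' ^ y').
Proof. by move=> nN Nx Ny; do !apply: eqmodM => //; apply: eqmodV. Qed.

Lemma eqmod_in G (N : set G) x y :
  is_subgroup N -> eqmod N x y -> N x -> N y.
Proof. by move=> sN Nxy /subgroupM/(_ Nxy); rewrite mulVKg; apply. Qed.

(** * Generated subgroups, commutator calculus and the three subgroups lemma *)

Lemma generated_ind G (A : set G) (P : G -> Prop) :
  P 1 -> (forall w a, A w -> P a -> P (w * a)) ->
  (forall w a, A w -> P a -> P (w^-1 * a)) ->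
  forall x, generated A x -> P x.
Proof.
move=> P1 PM PV x Ax.
(* These elements form a subgroup containing [A]; asking for [x^-1] as well makes the set closed
   under inverses. *)
suff /(_ _ P1)[+ _] : [set x | forall a, P a -> P (x * a) /\ P (x^-1 * a)] x.
  by rewrite mulg1.
apply: Ax; split; last by move=> w Aw a Pa; split; auto.
apply: is_subgroupP => [a Pa|y z Py Pz a Pa]; first by rewrite invg1 mul1g.
rewrite invgF -!mulgA; split.
  by apply Py; apply Pz.
by apply Pz; apply Py.
Qed.

Lemma hall_witt G (x y z : G) :
  [~ [~ x, y^-1], z] ^ y * [~ [~ y, z^-1], x] ^ z * [~ [~ z, x^-1], y] ^ x = 1.
Proof. by group_simp. Qed.

Lemma normal_commV G (N : set G) x y :
  normal_subgroup N -> N [~ x, y] -> N [~ x^-1, y].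
Proof.
move=> [sN JN] Nxy; have := JN _ x^-1 (subgroupV sN Nxy).
by group_simp.
Qed.

Lemma normal_commMl G (N : set G) x x' y :
  normal_subgroup N -> N [~ x, y] -> N [~ x', y] -> N [~ x * x', y].
Proof.
move=> [sN JN] Nxy Nx'y; have := subgroupM sN (JN _ x' Nxy) Nx'y.
by group_simp.
Qed.

Lemma normal_commC G (N : set G) x y :
  is_subgroup N -> N [~ x, y] -> N [~ y, x].
Proof. by move=> sN /(subgroupV sN); rewrite invgR. Qed.

Lemma generated_subgroup G (A : set G) : is_subgroup (generated A).
Proof.
apply: is_subgroupP => [H [sH _]|x y Ax Ay H HA]; first exact: subgroup1.
by apply: subgroupF (Ax H HA) (Ay H HA); case: HA.
Qed.

Lemma mem_commutator G (H K : set G) h k :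
  H h -> K k -> commutator_subgroup H K [~ h, k].
Proof. by move=> Hh Kk A [_]; apply; exists h => //; exists k. Qed.

Lemma commutator_subset G (H K N : set G) : is_subgroup N ->
  (forall h k, H h -> K k -> N [~ h, k]) -> commutator_subgroup H K `<=` N.
Proof.
move=> sN NHK x; apply; split=> // _ [h Hh [k Kk <-]]; exact: NHK.
Qed.

Lemma commutator_normal G (H K : set G) : normal_subgroup H ->
  normal_subgroup K -> normal_subgroup (commutator_subgroup H K).
Proof.
move=> [sH JH] [sK JK]; split; first exact: generated_subgroup.
have sHK : is_subgroup (commutator_subgroup H K).
  exact: generated_subgroup.
move=> x g; move: x; apply: generated_ind => [|w a|w a].
- by rewrite conj1g; apply: subgroup1.
- move=> [h Hh [k Kk <-]] ?; rewrite conjMg conjRg.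
  apply: (subgroupM sHK) => //.
  by apply: mem_commutator; auto.
move=> [h Hh [k Kk <-]] ?; rewrite conjMg conjVg conjRg.
apply: (subgroupM sHK) => //.
by apply: (subgroupV sHK); apply: mem_commutator; auto.
Qed.

Lemma commutator_subl G (H K : set G) :
  normal_subgroup H -> commutator_subgroup H K `<=` H.
Proof.
move=> [sH JH]; apply: commutator_subset => // h k Hh _.
by apply: subgroupM; auto; apply: subgroupV.
Qed.

(** The Hall-Witt identity handles the generators [[~ y, w]]; the elements commuting with [x] modulo
    [N] are closed under products and inverses. *)
Lemma three_subgroups G (N X Y W : set G) :
  normal_subgroup N -> is_subgroup X -> is_subgroup Y -> is_subgroup W ->
  (forall x y w, X x -> Y y -> W w -> N [~ [~ x, y], w]) ->
  (forall x y w, X x -> Y y -> W w -> N [~ [~ x, w], y]) ->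
  forall u x, commutator_subgroup Y W u -> X x -> N [~ u, x].
Proof.
move=> nN sX sY sW Nxyw Nxwy u x + Xx; have [sN JN] := nN.
have Nywx y w : Y y -> W w -> N [~ [~ y, w], x].
  move=> Yy Ww; have Yy' := subgroupV sY Yy; have Ww' := subgroupV sW Ww.
  (* With [w^-1] as third element the middle factor is [[~ [~ y, w], x] ^ w^-1]; the outer two lie
     in [N]. *)
  have := hall_witt x y w^-1; rewrite invgK => HW.
  have N1 : N ([~ [~ x, y^-1], w^-1] ^ y) by apply: JN; apply: Nxyw.
  have N3 : N ([~ [~ w^-1, x^-1], y] ^ x).
    apply: JN; rewrite -(invgR x^-1); apply: normal_commV => //.
    by apply: Nxwy => //; apply: subgroupV.
  rewrite -[[~ _, x]](conjgK w^-1); apply: JN.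
  set a := _ ^ y in HW N1; set c := _ ^ x in HW N3; set b := _ ^ w^-1 in HW *.
  have -> : b = a^-1 / c.
    by apply: (mulgI a); apply: (mulIg c); rewrite HW mulVKg mulVg.
  by apply: subgroupF => //; apply: subgroupV.
move: u; apply: generated_ind => [|w a|w a].
- by rewrite comm1g; apply: subgroup1.
- by move=> [y Yy [w' Ww <-]] Na; apply: normal_commMl => //; apply: Nywx.
move=> [y Yy [w' Ww <-]] Na; apply: normal_commMl => //.
by apply: normal_commV => //; apply: Nywx.
Qed.

(** * The lower and upper central series *)

Lemma lower_centralS G n :
  lower_central G n.+2 = commutator_subgroup (lower_central G n.+1) setT.
Proof. by []. Qed.

Lemma lower_central_normal G n : normal_subgroup (lower_central G n).
Proof.
case: n => [|n]; first exact: normalT.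
elim: n => [|n IHn]; first exact: normalT.
by apply: commutator_normal => //; apply: normalT.
Qed.

Lemma lower_central_le G m n :
  (m <= n)%N -> lower_central G n `<=` lower_central G m.
Proof.
elim: n => [|n IHn]; first by rewrite leqn0 => /eqP->.
rewrite leq_eqVlt => /predU1P[->//|le_mn] x Lx; apply: IHn => //.
case: n Lx {le_mn} => // n; rewrite lower_centralS.
by apply: commutator_subl; apply: lower_central_normal.
Qed.

(** Induction on [n] by the three subgroups lemma for gamma_(m+1), gamma_(n+1) and the whole group.
    The commutator is first swapped, since [three_subgroups] has the commutator subgroup on the
    left. *)
Lemma lower_central_comm G m n x y :
  lower_central G m.+1 x -> lower_central G n.+1 y ->
  lower_central G (m + n).+2 [~ x, y].
Proof.
move=> Lx Ly; apply: (normal_commC (proj1 (lower_central_normal G _))).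
elim: n m x y Lx Ly => [|n IHn] m x y Lx Ly.
  apply: (normal_commC (proj1 (lower_central_normal G _))).
  by rewrite addn0 lower_centralS; apply: mem_commutator.
move: Ly Lx; rewrite lower_centralS.
have nL := lower_central_normal G; have sL k := proj1 (nL k).
apply: (three_subgroups (nL (m + n.+1).+2) (sL m.+1) (sL n.+1)
         (proj1 (@normalT G))) => {}x {}y w Lx Ly _.
  rewrite addnS lower_centralS; apply: mem_commutator => //.
  by apply: (normal_commC (sL _)); apply: IHn.
rewrite addnS -addSn; apply: (normal_commC (sL _)); apply: IHn => //.
by rewrite lower_centralS; apply: mem_commutator.
Qed.

(** Replaces commuting cosets by a condition on commutators, the form in which the upper central
    series is used below. *)
Lemma upper_central_rec G (N : set G) x : normal_subgroup N ->
  (left_coset N @^-1` center_quotient N) x <-> forall g, N [~ x, g].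
Proof.
move=> [sN JN]; split=> [[_ /(_ (left_coset N _)) xN] g|Nx].
  have H1 := subgroup1 sN; have mem1 y : left_coset N y y.
    by exists 1; rewrite ?mulg1.
  (* The element [x * g] lies in the product of the two cosets in either order; comparing the two
     expressions isolates [[~ x, g]]. *)
  have [_ [n Nn <-] [_ [n' Nn' <-] E]] :
      set_product (left_coset N g) (left_coset N x) (x * g).
    rewrite -xN; last by exists g.
    by exists x => //; exists g.
  have -> : [~ x, g] = n ^ x * n'.
    by apply: (mulgI (g * x)); rewrite -commgC -E; group_simp.
  by apply: subgroupM => //; apply: JN.
split=> [|_ [g _ <-]]; first by exists x.
have sub a b : N [~ a, b] ->
  set_product (left_coset N a) (left_coset N b) `<=`
  set_product (left_coset N b) (left_coset N a).
  move=> Nab _ [_ [n Nn <-] [_ [n' Nn' <-] <-]].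
  exists b; first by exists 1; rewrite ?mulg1 //; apply: subgroup1.
  exists (a * ([~ a, b] * (n ^ b * n'))); last by group_simp.
  exists ([~ a, b] * (n ^ b * n')) => //.
  apply: (subgroupM sN) => //; apply: (subgroupM sN) => //; exact: JN.
apply/seteqP; split; apply: sub => //.
exact: normal_commC.
Qed.

Lemma upper_central_normal G n : normal_subgroup (upper_central G n).
Proof.
elim: n => [|n nZ]; first exact: normal_trivial.
have ZP x := upper_central_rec x nZ; have [sZ JZ] := nZ.
split; last first.
  move=> x g /ZP Zx; apply/ZP => h; rewrite -[h](conjgKV g) -conjRg.
  exact: JZ.
apply: is_subgroupP; first by apply/ZP => g; rewrite comm1g; apply: subgroup1.
move=> x y /ZP Zx /ZP Zy; apply/ZP => g.
by apply: normal_commMl => //; apply: normal_commV.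
Qed.

Lemma upper_centralSP G n x :
  upper_central G n.+1 x <-> forall g, upper_central G n [~ x, g].
Proof. exact: upper_central_rec (upper_central_normal G n). Qed.

(** * Sets that are finite modulo a subgroup *)

(* For a subgroup H of K, finite_mod H K says that |K : H| is finite, but A
   need not be a subgroup, nor contain N. *)
Definition finite_mod G (N A : set G) : Prop :=
  exists l : seq G, forall a, A a -> exists2 b, b \in l & eqmod N b a.

(** One element of [A] is kept for each value whose fiber meets [A]; the induction removes the whole
    fiber of the first value from [A]. *)
Lemma fiber_representatives G (T : eqType) (l : seq T) (P : T -> G -> Prop)
    (A : set G) :
  (forall a, A a -> exists2 v, v \in l & P v a) ->
  exists l' : seq G, (forall b, b \in l' -> A b) /\
    forall a, A a -> exists2 b, b \in l' & exists v, P v b /\ P v a.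
Proof.
elim: l A => [|v l IHl] A AP; first by exists [::]; split=> // a /AP[].
have [|l' [Al' l'P]] := IHl [set a | A a /\ ~ P v a].
  by move=> a [/AP[w + Pwa] nPva]; rewrite inE => /predU1P[E|]; [|exists w];
     rewrite // -E in nPva.
have [[a0 [Aa0 Pva0]]|no_v] := pselect (exists a, A a /\ P v a).
  exists (a0 :: l'); split=> [b|a Aa].
    by rewrite inE => /predU1P[->|/Al'[]].
  have [Pva|nPva] := pselect (P v a).
    by exists a0; [rewrite mem_head|exists v].
  by have [//|b bl' Hb] := l'P a; exists b; rewrite // inE bl' orbT.
exists l'; split=> [b /Al'[]//|a Aa]; apply: l'P; split=> // Pva.
by apply: no_v; exists a.
Qed.

Lemma finite_mod_rep G (N A : set G) : is_subgroup N -> finite_mod N A ->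
  exists l : seq G, (forall b, b \in l -> A b) /\
    forall a, A a -> exists2 b, b \in l & eqmod N b a.
Proof.
move=> sN [l /fiber_representatives[l' [Al' l'P]]]; exists l'; split=> // a.
move=> /l'P[b bl'].
move=> [v [Nvb Nva]]; exists b => //; apply: (eqmod_trans sN) Nva.
exact: eqmod_sym.
Qed.

Lemma finite_modS G (N A B : set G) :
  A `<=` B -> finite_mod N B -> finite_mod N A.
Proof. by move=> AB [l lP]; exists l => a /AB/lP. Qed.

Lemma finite_mod1 G (N : set G) (x : G) :
  is_subgroup N -> finite_mod N [set y | eqmod N x y].
Proof. by move=> sN; exists [:: x] => y Nxy; exists x; rewrite ?inE. Qed.

Lemma finite_mod_bigcup G (T : eqType) (l : seq T) (N : set G)
    (F : T -> set G) : (forall x, x \in l -> finite_mod N (F x)) ->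
  finite_mod N [set a | exists2 x, x \in l & F x a].
Proof.
elim: l => [|x l IHl] lF; first by exists [::] => a [].
have [|l1 l1P] := IHl; first by move=> y yl; apply: lF; rewrite inE yl orbT.
have [l2 l2P] := lF x (mem_head x l).
exists (l1 ++ l2) => a [y]; rewrite inE => /predU1P[->|yl] Fa.
  by have [b bl ?] := l2P a Fa; exists b; rewrite // mem_cat bl orbT.
have [|b bl ?] := l1P a; first by exists y.
by exists b; rewrite // mem_cat bl.
Qed.

Lemma finite_mod_map2 G (M N A B C : set G) (f : G -> G -> G) :
  is_subgroup N ->
  (forall a a' b b', eqmod M a a' -> eqmod M b b' ->
     eqmod N (f a b) (f a' b')) ->
  finite_mod M A -> finite_mod M B ->
  (forall c, C c -> exists a b, [/\ A a, B b & eqmod N (f a b) c]) ->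
  finite_mod N C.
Proof.
move=> sN fP [l1 l1P] [l2 l2P] CP.
exists [seq f a b | a <- l1, b <- l2] => c /CP[a [b [/l1P[a' al Na]]]].
move=> /l2P[b' bl Nb] Nc; exists (f a' b'); first exact: allpairs_f.
exact: (eqmod_trans sN) (fP _ _ _ _ Na Nb) Nc.
Qed.

(** The two moduli may differ: when [M] is central modulo [N], commutation with a fixed element
    turns finiteness modulo [M] into finiteness modulo [N]. *)
Lemma finite_mod_map G (M N A C : set G) (f : G -> G) :
  is_subgroup N -> (forall a a', eqmod M a a' -> eqmod N (f a) (f a')) ->
  finite_mod M A -> (forall c, C c -> exists2 a, A a & eqmod N (f a) c) ->
  finite_mod N C.
Proof.
move=> sN fP [l lP] CP; exists (map f l) => c /CP[a /lP[b bl Nba] Nc].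
by exists (f b); [apply: map_f|apply: (eqmod_trans sN) Nc; apply: fP].
Qed.

Lemma finite_mod_trans G (H K L : set G) :
  finite_mod K L -> finite_mod H K -> finite_mod H L.
Proof.
move=> [l1 l1P] [l2 l2P]; exists [seq a * b | a <- l1, b <- l2] => c /l1P.
move=> [a al /l2P[b bl Hb]]; exists (a * b); first exact: allpairs_f.
by move: Hb; rewrite /eqmod; group_simp.
Qed.

Lemma finite_mod_cap G (K H1 H2 : set G) : is_subgroup H1 -> is_subgroup H2 ->
  finite_mod H1 K -> finite_mod H2 K -> finite_mod (H1 `&` H2) K.
Proof.
move=> s1 s2 [l1 l1P] [l2 l2P].
have [|l [_ lP]] := @fiber_representatives G _ [seq (a, b) | a <- l1, b <- l2]
   (fun v x => eqmod H1 v.1 x /\ eqmod H2 v.2 x) K.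
  move=> x Kx; have [[a al Ha] [b bl Hb]] := (l1P x Kx, l2P x Kx).
  by exists (a, b) => //; apply: allpairs_f.
exists l => x /lP[y yl [v [[Hy1 Hy2] [Hx1 Hx2]]]]; exists y => //; split.
  by apply: (eqmod_trans s1) Hx1; apply: eqmod_sym.
by apply: (eqmod_trans s2) Hx2; apply: eqmod_sym.
Qed.

Lemma finite_mod_seq_cap G (T : eqType) (l : seq T) (K : set G)
    (H : T -> set G) : (forall t, t \in l -> is_subgroup (H t)) ->
  (forall t, t \in l -> finite_mod (H t) K) ->
  finite_mod [set x | forall t, t \in l -> H t x] K.
Proof.
elim: l => [|t l IHl] sH fH.
  by exists [:: 1] => a _; exists 1; rewrite ?mem_head.
have IH : finite_mod [set x | forall t, t \in l -> H t x] K.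
  by apply: IHl => u ul; [apply: sH|apply: fH]; rewrite inE ul orbT.
have sI : is_subgroup [set x | forall t, t \in l -> H t x].
  apply: is_subgroupP => [u ul|x y Hx Hy u ul].
    by apply: subgroup1; apply: sH; rewrite inE ul orbT.
  by apply: subgroupF; auto; apply: sH; rewrite inE ul orbT.
have tl := mem_head t l.
have [l' l'P] := finite_mod_cap (sH t tl) sI (fH t tl) IH.
exists l' => a /l'P[b bl [Hb1 Hb2]]; exists b => // u.
by rewrite inE => /predU1P[->|/Hb2].
Qed.

Lemma finite_mod_centralizer G (N K : set G) t :
  normal_subgroup N -> is_subgroup K -> finite_mod N [set [~ k, t] | k in K] ->
  finite_mod [set k | K k /\ N [~ k, t]] K.
Proof.
move=> nN sK [l lP]; have [sN JN] := nN.
(* Elements with the same [[~ k, t]] modulo [N] form right cosets of the centralizer; using [k^-1]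
   gives the left cosets of [eqmod]. *)
have [|l' [Kl' l'P]] := @fiber_representatives G _ l
   (fun v x => eqmod N v [~ x^-1, t]) K.
  by move=> k Kk; apply: lP; exists k^-1 => //; apply: subgroupV.
exists l' => k Kk; have [b bl [v [Nvb Nvk]]] := l'P k Kk.
exists b => //; split.
  by apply: (subgroupM sK) => //; apply: (subgroupV sK); apply: Kl'.
(* Conjugation by this element turns the quotient of the two commutators into [[~ t, b^-1 * k]]. *)
have := JN _ (t^-1 * b * t * b^-1 * k) (eqmod_trans sN (eqmod_sym sN Nvb) Nvk).
move/(subgroupV sN).
by rewrite /eqmod; group_simp.
Qed.

(** * Finitely many commutators modulo [N], when [N'] is central modulo [N] *)

Lemma eqmod_commR G (N M : set G) a a' y : normal_subgroup N ->
  (forall x g, M x -> N [~ x, g]) ->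
  eqmod M a a' -> eqmod N [~ a, y] [~ a', y].
Proof.
move=> nN MN; have [sN JN] := nN; rewrite {1}/eqmod.
set z := _ * _ => Mz; have -> : a' = a * z by rewrite mulVKg.
have -> : [~ a * z, y] = [~ a, y] ^ z * [~ z, y] by group_simp.
rewrite -[X in eqmod _ X]mulg1; apply: eqmodM => //.
  by apply: (normal_commC sN); apply: MN.
by rewrite /eqmod invg1 mul1g; apply: MN.
Qed.

(** Replacing [a] by [a * z], with [z] central modulo [N], contributes [z^-1] and [z], which
    cancel. *)
Lemma eqmod_conj_quotient G (N M : set G) a a' u s : normal_subgroup N ->
  (forall x g, M x -> N [~ x, g]) ->
  eqmod M a a' -> eqmod N (a^-1 ^ u * a ^ s) (a'^-1 ^ u * a' ^ s).
Proof.
move=> nN MN; have [sN JN] := nN; rewrite {1}/eqmod.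
set z := _ * _ => Mz; have -> : a' = a * z by rewrite mulVKg.
set c := _ ^ u * _.
have -> : (a * z)^-1 ^ u * (a * z) ^ s = (z ^ u)^-1 * c * z ^ s.
  by rewrite /c; group_simp.
apply: (eqmod_trans (y := z^-1 * c * z) sN).
  have -> : z^-1 * c * z = c ^ z by group_simp.
  by apply: (normal_commC sN); apply: MN.
apply: (eqmodM nN _ (MN _ _ Mz)); apply: (eqmodM nN _ (eqmod_refl c sN)).
by apply: (eqmodV nN); apply: MN.
Qed.

(** With [u = [~ e, s]] and [x = [~ e, y]] the right side is [[~ u, y]^-1 * (x^-1 ^ u * x ^ s)].
    Only [x] modulo [N'] matters in the second factor, and the rest is governed by commutators with
    [u], which is one step further down the lower central series than [e]. *)
Lemma commutator_conj_mod G (e s y : G) :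
  [~ e ^ (s * y), [~ y, s]] =
  [~ [~ e, s], y]^-1 * ([~ e, y]^-1 ^ [~ e, s] * [~ e, y] ^ s).
Proof. by group_simp. Qed.

Section FiniteConjugacy.

Variables (G : groupType) (N N' : set G) (n : nat).
Hypotheses (nN : normal_subgroup N) (nN' : normal_subgroup N').
Hypothesis N'N : forall x g, N' x -> N [~ x, g].
Hypothesis fL : finite_mod N' (lower_central G n.+1).

Let sN : is_subgroup N. Proof. by case: nN. Qed.
Let sN' : is_subgroup N'. Proof. by case: nN'. Qed.

Let base k y : (n <= k)%N ->
  finite_mod N [set [~ e, y] | e in lower_central G k.+1].
Proof.
move=> le_nk; apply: (finite_mod_map (f := fun e => [~ e, y]) sN) fL _.
  by move=> a a'; apply: eqmod_commR.
move=> _ [e Le <-]; exists e; last exact: eqmod_refl.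
by apply: lower_central_le Le.
Qed.

Lemma finite_mod_commutators k m y : (n <= k + m)%N ->
  lower_central G m.+1 y ->
  finite_mod N [set [~ e, y] | e in lower_central G k.+1].
Proof.
(* As [d] bounds [n - k], the induction runs upwards in [k] until [n <= k], where [base] applies. *)
move: {2}(n - k)%N (leqnn (n - k)) => d.
elim: d k m y => [|d IHd] k m y le_d le_n; first by move=> _; apply: base; lia.
have [/base//|lt_kn] := leqP n k.
case: m le_n => [|m] le_n; first lia.
rewrite lower_centralS; move: y.
have core y s : lower_central G m.+1 y ->
    finite_mod N [set [~ e, [~ y, s]] | e in lower_central G k.+1].
  move=> Ly; have [l [Ll lP]] := finite_mod_rep sN' fL.
  (* The right side of [commutator_conj_mod], with [p] for [[~ u, y]] and [q] for [[~ u, x]], so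
     that [x ^ u] is [x * q^-1]. *)
  pose f x p q := p^-1 * ((x * q^-1)^-1 * x ^ s).
  pose A y := [set [~ u, y] | u in lower_central G k.+2].
  pose F x := [set c | exists p q, [/\ A y p, A x q & eqmod N (f x p q) c]].
  have fF x : x \in l -> finite_mod N (F x).
    move=> /Ll Lx.
    apply: (finite_mod_map2 (A := A y) (B := A x) (f := f x) (M := N)
              sN).
    - move=> p p' q q' Np Nq; apply: (eqmodM nN (eqmodV nN Np)).
      apply: (eqmodM nN _ (eqmod_refl _ sN)); apply: (eqmodV nN).
      exact: (eqmodM nN (eqmod_refl _ sN) (eqmodV nN Nq)).
    - by apply: (IHd k.+1 m) => //; lia.
    - by apply: (IHd k.+1 n) => //; lia.
    by move=> c Fc.
  apply: finite_modS (finite_mod_bigcup fF) => _ [e0 Le0 <-].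
  have [sL JL] := lower_central_normal G k.+1.
  (* Normality of gamma_(k+1) allows [e0] to take the conjugated form that the identity requires. *)
  pose e := e0 ^ (s * y)^-1; have Le : lower_central G k.+1 e by apply: JL.
  have -> : e0 = e ^ (s * y) by rewrite conjgKV.
  have Lu : lower_central G k.+2 [~ e, s].
    by rewrite lower_centralS; apply: mem_commutator.
  (* This commutator lies in gamma_(k+m+2), hence in gamma_(n+1), so it is congruent modulo [N'] to
     an entry of [l]. *)
  have [|x xl Nx] := lP [~ e, y].
    by apply: lower_central_le (lower_central_comm Le Ly); lia.
  exists x => //; exists [~ [~ e, s], y], [~ [~ e, s], x]; split.
  - by exists [~ e, s].
  - by exists [~ e, s].
  rewrite commutator_conj_mod; apply: (eqmodM nN (eqmod_refl _ sN)).
  have -> : x * [~ [~ e, s], x]^-1 = x ^ [~ e, s].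
    by rewrite invgR commgEl mulVKg.
  by rewrite -conjVg; apply: eqmod_conj_quotient Nx.
apply: generated_ind => [|v a|v a].
- apply: finite_modS (finite_mod1 1 sN) => _ [e _ <-]; rewrite commg1.
  exact: eqmod_refl.
- move=> [y Ly [s _ <-]] fa.
  apply: (finite_mod_map2 (f := fun p q => p * q ^ a) sN (M := N) _ fa).
  + move=> p p' q q' Np Nq; apply: (eqmodM nN Np).
    exact: (eqmodJ nN Nq (eqmod_refl _ sN)).
  + exact: core Ly.
  move=> _ [e Le <-]; exists [~ e, a], [~ e, [~ y, s]].
  split; [by exists e|by exists e|].
  set w := [~ y, s]; have -> : [~ e, w * a] = [~ e, a] * [~ e, w] ^ a.
    by group_simp.
  exact: eqmod_refl.
move=> [y Ly [s _ <-]] fa.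
apply: (finite_mod_map2 (f := fun p q => p * q^-1 ^ ([~ y, s]^-1 * a)) sN
          (M := N) _ fa).
- move=> p p' q q' Np Nq; apply: (eqmodM nN Np).
  exact: (eqmodJ nN (eqmodV nN Nq) (eqmod_refl _ sN)).
- exact: core Ly.
move=> _ [e Le <-]; exists [~ e, a], [~ e, [~ y, s]].
split; [by exists e|by exists e|].
set w := [~ y, s].
have -> : [~ e, w^-1 * a] = [~ e, a] * [~ e, w]^-1 ^ (w^-1 * a).
  by group_simp.
exact: eqmod_refl.
Qed.

End FiniteConjugacy.

(** * Schur's argument for commutator subgroups *)

Lemma eqmodX G (N : set G) x y k : normal_subgroup N ->
  eqmod N x y -> eqmod N (x ^+ k) (y ^+ k).
Proof.
move=> nN Nxy; elim: k => [|k IHk]; first exact: eqmod_refl (proj1 nN).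
by rewrite !expgS; apply: (eqmodM nN).
Qed.

(** Pigeonhole on the powers of [x] with exponents from 0 to [size l]; the length of [l] bounds the
    exponent uniformly in [x]. *)
Lemma finite_mod_torsion G (N X : set G) :
  is_subgroup N -> is_subgroup X -> finite_mod N X ->
  exists n, forall x, X x -> exists k, [/\ (0 < k)%N, (k <= n)%N & N (x ^+ k)].
Proof.
move=> sN sX [l lP]; exists (size l) => x Xx.
have Xk k : X (x ^+ k).
  by elim: k => [|k IHk]; [apply: subgroup1|rewrite expgS; apply: subgroupM].
have /choice[f fP] k : exists b, b \in l /\ eqmod N b (x ^+ k).
  by have [b] := lP _ (Xk k); exists b.
have /(uniqPn 1)[i [j []]] : ~~ uniq (map f (iota 0 (size l).+1)).
  apply: contraT; rewrite negbK => /uniq_leq_size.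
  move=> /(_ l); rewrite size_map size_iota ltnn; apply.
  by move=> _ /mapP[k _ ->]; case: (fP k).
rewrite size_map size_iota => lt_ij lt_jl.
rewrite !(nth_map 0%N) ?size_iota ?nth_iota //; try exact: ltn_trans lt_jl.
rewrite !add0n => eq_f; exists (j - i)%N; rewrite subn_gt0 lt_ij; split=> //.
  by rewrite (leq_trans (leq_subr _ _)).
have [_ Ni] := fP i; have [_ Nj] := fP j; rewrite -eq_f in Nj.
have := eqmod_trans sN (eqmod_sym sN Ni) Nj.
by rewrite /eqmod -{1}(subnKC (ltnW lt_ij)) expgnDr mulKg.
Qed.

Lemma size_le_count (T : eqType) (l s : seq T) n : {subset s <= l} ->
  (forall w, w \in l -> (count_mem w s <= n)%N) -> (size s <= n * size l)%N.
Proof.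
elim: l s => [|w l IHl] s sl sn.
  by case: s sl {sn} => // x s /(_ x (mem_head _ _)).
rewrite mulnS -(count_predC (pred1 w)) leq_add ?sn ?mem_head //.
rewrite -size_filter; apply: IHl => [x|x xl].
  by rewrite mem_filter => /andP[/= /negPf xw /sl]; rewrite inE xw.
rewrite count_filter; apply: leq_trans (sn x _); last by rewrite inE xl orbT.
by apply: sub_count => y /andP[].
Qed.

(** Moving [w ^+ c] to the left past [x] replaces [x] by [x ^ (w ^+ c)], which is congruent to an
    entry of [l]. *)
Lemma collect_power G (N : set G) (l s : seq G) w c : normal_subgroup N ->
  (forall a b, a \in l -> exists2 a', a' \in l & eqmod N (a ^ b) a') ->
  {subset s <= l} -> (c <= count_mem w s)%N ->
  exists s', [/\ {subset s' <= l}, (size s' + c)%N = size s &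
    eqmod N (\prod_(x <- s) x) (w ^+ c * \prod_(x <- s') x)].
Proof.
move=> nN lJ; have sN := proj1 nN.
elim: s c => [|x s IHs] c sl /=.
  rewrite leqn0 => /eqP->; exists [::]; split=> //.
  by rewrite mul1g; apply: eqmod_refl.
have xl : x \in l by apply: sl; rewrite mem_head.
have {}sl : {subset s <= l} by move=> y ys; apply: sl; rewrite inE ys orbT.
have [xw|xw] := eqVneq x w; first subst w.
  case: c => [_|c].
    exists (x :: s); split; first by move=> y; rewrite inE => /predU1P[->|/sl].
      by rewrite addn0.
    by rewrite mul1g; apply: eqmod_refl.
  rewrite add1n ltnS => /(IHs _ sl)[s' [s'l <- Ns']].
  exists s'; split=> //; first by rewrite addnS.
  rewrite big_cons expgS -mulgA; exact: (eqmodM nN (eqmod_refl _ sN)).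
rewrite add0n => /(IHs _ sl)[s' [s'l <- Ns']].
have [y yl Ny] := lJ x (w ^+ c) xl.
exists (y :: s'); split=> [z|//|].
  by rewrite inE => /predU1P[->|/s'l].
rewrite !big_cons; set P := \prod_(z <- s') z in Ns' *.
apply: eqmod_trans (eqmodM nN (eqmod_refl x sN) Ns') _ => //.
have -> : x * (w ^+ c * P) = w ^+ c * (x ^ (w ^+ c) * P) by group_simp.
apply: (eqmodM nN (eqmod_refl _ sN)).
exact: (eqmodM nN Ny (eqmod_refl _ sN)).
Qed.

(** Centrality of [w ^+ k.+1] exchanges the last two factors of
    [w ^+ k.+2 = x^-1 * (x ^ g * w ^+ k.+1)], and the result is [(w ^+ k) ^ x * [~ x ^+ 2, g]]. Thus
    [k.+2] commutators become [k.+1]. *)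
Lemma commutator_power G (N : set G) x g k : normal_subgroup N ->
  (forall h, N [~ [~ x, g] ^+ k.+1, h]) ->
  eqmod N ([~ x, g] ^+ k.+2) ([~ x, g ^ x] ^+ k * [~ x ^+ 2, g]).
Proof.
move=> nN; set w := [~ x, g] => Nw; have sN := proj1 nN.
have -> : [~ x, g ^ x] ^+ k = (w ^+ k) ^ x.
  by rewrite conjXg conjRg [x ^ x]mulKg.
have -> : w ^+ k.+2 = x^-1 * (x ^ g * w ^+ k.+1).
  by rewrite expgS -[LHS]mulgA.
have -> : (w ^+ k) ^ x * [~ x ^+ 2, g] = x^-1 * (w ^+ k.+1 * x ^ g).
  by rewrite (expgSr w) expg2; set v := w ^+ k; rewrite /w; group_simp.
apply: (eqmodM nN (eqmod_refl _ sN)).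
set W := w ^+ k.+1 in Nw *; set y := x ^ g.
by have := Nw y; rewrite /eqmod; group_simp.
Qed.

Lemma finite_mod_short_products G (N : set G) (l : seq G) n :
  normal_subgroup N ->
  finite_mod N [set u | exists s : seq G,
    [/\ {subset s <= l}, (size s <= n)%N & eqmod N (\prod_(x <- s) x) u]].
Proof.
move=> nN; have sN := proj1 nN; elim: n => [|n IHn].
  apply: finite_modS (finite_mod1 1 sN) => u [s [_]].
  by rewrite leqn0 size_eq0 => /eqP->; rewrite big_nil.
have fl : finite_mod N [set x | x \in 1 :: l].
  by exists (1 :: l) => x xl; exists x => //; apply: eqmod_refl.
apply: (finite_mod_map2 (f := mul) sN _ fl IHn).
  by move=> a a' b b'; apply: eqmodM.
move=> u [[|x s] [sl sn Nu]].
  exists 1, 1; split; rewrite /= ?mem_head ?mul1g //.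
    by exists [::]; rewrite big_nil; split=> //; apply: eqmod_refl.
  by rewrite big_nil in Nu.
exists x, (\prod_(y <- s) y); split; last by rewrite big_cons in Nu.
  by rewrite /= inE sl ?orbT ?mem_head.
exists s; split=> //; last exact: eqmod_refl.
by move=> y ys; apply: sl; rewrite inE ys orbT.
Qed.

(* Schur's argument: a long product of commutators contains many copies of some
   commutator w, which conjugation gathers into a power of w; and if w ^+ k is
   central then w ^+ k.+1 is a product of k commutators. *)
Lemma finite_mod_commutator_subgroup G (N N' X : set G) :
  normal_subgroup N -> normal_subgroup N' -> normal_subgroup X ->
  (forall x g, N' x -> N [~ x, g]) -> finite_mod N' X ->
  finite_mod N [set [~ x, g] | x in X & g in setT] ->
  finite_mod N (commutator_subgroup X setT).
Proof.
move=> nN [sN' _] [sX JX] N'N fX /[dup] _; have sN := proj1 nN.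
move=> /(finite_mod_rep sN)[l [lW lP]].
have repl x g : X x -> exists2 w, w \in l & eqmod N w [~ x, g].
  by move=> Xx; apply: lP; exists x => //; exists g.
have lJ a b : a \in l -> exists2 a', a' \in l & eqmod N (a ^ b) a'.
  move=> /lW[x Xx [g _ <-]].
  have [a' a'l Na'] := repl (x ^ b) (g ^ b) (JX _ _ Xx).
  by exists a' => //; apply: (eqmod_sym sN); rewrite conjRg.
have [n nP] := finite_mod_torsion sN' sX fX.
have shorten (s : seq G) : {subset s <= l} -> (n * size l < size s)%N ->
    exists s' : seq G, [/\ {subset s' <= l}, (size s' < size s)%N &
      eqmod N (\prod_(x <- s') x) (\prod_(x <- s) x)].
  move=> sl lt_s.
  have [w wl lt_w] : exists2 w, w \in l & (n < count_mem w s)%N.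
    apply: contrapT => no_w; move: lt_s; rewrite ltnNge size_le_count //.
    move=> w wl; rewrite leqNgt; apply/negP => lt_w.
    by apply: no_w; exists w.
  have [x Xx [g _ def_w]] := lW w wl.
  have Xw : X w.
    by rewrite -def_w; apply: (subgroupM sX); [apply: subgroupV|apply: JX].
  have [[|k] [// _ le_kn Nk]] := nP w Xw.
  (* Since [k.+1 <= n], there are [k.+2] copies of [w] to collect; [k] copies of [a] and one [b]
     will replace them, one factor fewer. *)
  have le_kw : (k.+2 <= count_mem w s)%N by apply: leq_trans lt_w.
  have [s' [s'l size_s' Ns']] := collect_power nN lJ sl le_kw.
  have [a al Na] := repl x (g ^ x) Xx.
  have [b bl Nb] : exists2 b, b \in l & eqmod N b [~ x ^+ 2, g].
    by apply: repl; rewrite expg2; apply: subgroupM.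
  exists (nseq k a ++ b :: s'); split.
  - move=> y; rewrite mem_cat inE => /or3P[|/eqP->//|/s'l//].
    by rewrite mem_nseq => /andP[_ /eqP->].
  - by rewrite size_cat size_nseq -size_s' !addnS addnC.
  apply: (eqmod_sym sN); apply: (eqmod_trans sN) Ns' _.
  rewrite big_cat big_cons big_nseq iter_mulg_1 /= mulgA.
  apply: (eqmodM nN _ (eqmod_refl _ sN)).
  apply: (@eqmod_trans _ _ ([~ x, g ^ x] ^+ k * [~ x ^+ 2, g])) => //.
    rewrite -def_w; apply: (commutator_power nN) => h.
    by rewrite def_w; apply: N'N.
  apply: (eqmod_sym sN); apply: (eqmodM nN) => //.
  exact: (eqmodX _ nN).
have prods u : commutator_subgroup X setT u ->
    exists s : seq G, {subset s <= l} /\ eqmod N (\prod_(x <- s) x) u.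
  have step x g v : X x ->
      (exists s : seq G, {subset s <= l} /\ eqmod N (\prod_(x <- s) x) v) ->
      exists s : seq G, {subset s <= l} /\
        eqmod N (\prod_(x <- s) x) ([~ x, g] * v).
    move=> Xx [s [sl Ns]]; have [w wl Nw] := repl x g Xx.
    exists (w :: s); split; last first.
      by rewrite big_cons; apply: (eqmodM nN Nw Ns).
    by move=> y; rewrite inE => /predU1P[->|/sl].
  move: u; apply: generated_ind => [|v u|v u].
  - by exists [::]; rewrite big_nil; split=> //; apply: eqmod_refl.
  - by move=> [x Xx [g _ <-]]; apply: step.
  move=> [x Xx [g _ <-]].
  (* The inverse is again a commutator with first entry in [X], so products of entries of [l]
     suffice. *)
  have -> : [~ x, g]^-1 = [~ x ^ g, g^-1] by group_simp.
  by apply: step; apply: JX.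
apply: finite_modS (finite_mod_short_products l (n * size l) nN).
move=> u /prods[s]; move: {2}(size s) (leqnn (size s)) => m.
elim: m s => [|m IHm] s le_s [sl Ns].
  by exists s; split=> //; apply: leq_trans le_s _.
have [le_sl|lt_s] := leqP (size s) (n * size l); first by exists s.
have [s' [s'l lt_s' Ns']] := shorten s sl lt_s.
apply: (IHm s'); first by rewrite -ltnS; apply: leq_trans lt_s' _.
by split=> //; apply: (eqmod_trans sN) Ns' Ns.
Qed.

(** * One step along both central series, and centralizers of finite index *)

Lemma finite_modW G (N N' A : set G) :
  N `<=` N' -> finite_mod N A -> finite_mod N' A.
Proof.
by move=> NN' [l lP]; exists l => a /lP[b bl Nba]; exists b => //; apply: NN'.
Qed.

Definition centralizer_mod G (N X : set G) : set G :=
  [set c | forall x, X x -> N [~ x, c]].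

Lemma centralizer_mod_normal G (N X : set G) : normal_subgroup N ->
  normal_subgroup X -> normal_subgroup (centralizer_mod N X).
Proof.
move=> nN [sX JX]; have [sN JN] := nN; split; last first.
  move=> c g Cc x Xx; rewrite -[x](conjgKV g) -conjRg; apply: JN; apply: Cc.
  exact: JX.
apply: is_subgroupP => [x _|c d Cc Cd x Xx].
  by rewrite commg1; apply: subgroup1.
apply: (normal_commC sN); apply: normal_commMl => //.
  by apply: (normal_commC sN); apply: Cc.
by apply: normal_commV => //; apply: (normal_commC sN); apply: Cd.
Qed.

Section CentralExtension.

Variables (G : groupType) (N N' : set G) (n : nat).
Hypotheses (nN : normal_subgroup N) (nN' : normal_subgroup N').
Hypothesis N'N : forall x g, N' x -> N [~ x, g].
Hypothesis fL : finite_mod N' (lower_central G n.+1).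

Let sN : is_subgroup N. Proof. by case: nN. Qed.
Let sN' : is_subgroup N'. Proof. by case: nN'. Qed.

Let conj_fin t : lower_central G n.+1 t ->
  finite_mod N [set [~ g, t] | g in setT].
Proof.
by move=> Lt; apply: (finite_mod_commutators (k := 0) nN nN' N'N fL _ Lt).
Qed.

(** Modulo [N], [[~ x, g]] depends on [x] only modulo [N'], and each of the finitely many
    representatives has finitely many commutators by [conj_fin]; Schur's argument then applies. *)
Lemma lower_central_finite_modS : finite_mod N (lower_central G n.+2).
Proof.
rewrite lower_centralS.
apply: (finite_mod_commutator_subgroup nN nN' _ N'N fL).
  exact: lower_central_normal.
have [l [Ll lP]] := finite_mod_rep sN' fL.
pose F t := [set c | exists2 g, [set: G] g & eqmod N [~ t, g] c].
have fF t : t \in l -> finite_mod N (F t).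
  move=> /Ll/conj_fin ft.
  apply: (finite_mod_map (f := fun x => x^-1) (M := N) sN _ ft).
    by move=> a a'; apply: eqmodV.
  move=> c [g _ Nc]; exists [~ g, t]; first by exists g.
  by rewrite invgR.
apply: finite_modS (finite_mod_bigcup fF) => _ [x Lx [g _ <-]].
have [t tl Nt] := lP x Lx; exists t => //; exists g => //.
exact: eqmod_commR Nt.
Qed.

(** It suffices to centralize representatives of gamma_(n+1) modulo [N'], as [N'] is central modulo
    [N]; this is a finite intersection. *)
Lemma finite_mod_centralizer_lower_central :
  finite_mod (centralizer_mod N (lower_central G n.+1)) setT.
Proof.
have [l [Ll lP]] := finite_mod_rep sN' fL.
pose H t := [set g | [set: G] g /\ N [~ g, t]].
have sH t : is_subgroup (H t).
  apply: is_subgroupP => [|a b [_ Na] [_ Nb]]; split=> //.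
    by rewrite comm1g; apply: subgroup1.
  by apply: normal_commMl => //; apply: normal_commV.
have fH t : t \in l -> finite_mod (H t) setT.
  move=> /Ll/conj_fin; apply: finite_mod_centralizer => //.
  by case: (@normalT G).
apply: finite_modW (finite_mod_seq_cap (fun t _ => sH t) fH) => c Hc x Lx.
have [t tl Nt] := lP x Lx; have [_ Nct] := Hc t tl.
apply: eqmod_in (eqmod_commR c nN N'N Nt) _ => //.
exact: normal_commC.
Qed.

End CentralExtension.

Lemma lower_upper_finite_mod G i k : (k <= i)%N ->
  finite_mod (upper_central G i) (lower_central G i.+1) ->
  finite_mod (upper_central G (i - k)) (lower_central G (i + k).+1).
Proof.
move=> + fL; elim: k => [|k IHk] lt_ki; first by rewrite subn0 addn0.
have {IHk} := IHk (ltnW lt_ki); rewrite -[(i - k)%N]prednK ?subn_gt0 //.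
rewrite -subnS addnS; apply: lower_central_finite_modS.
- exact: upper_central_normal.
- exact: upper_central_normal.
by move=> x g /upper_centralSP.
Qed.

(** * Iterated commutators of [C] with the whole group *)

Definition iterated_commutator G (C : set G) j :=
  iter j (fun H => commutator_subgroup H setT) C.

Section IteratedCommutator.

Variables (G : groupType) (C : set G) (i : nat).
Hypothesis nC : normal_subgroup C.
Hypothesis CZ : forall k, (k < i)%N ->
  C `<=` centralizer_mod (upper_central G (i - k.+1))
                         (lower_central G (i + k).+1).

Let nZ n := upper_central_normal G n.
Let sZ n := proj1 (nZ n).
Let sT := proj1 (@normalT G).
Let M := iterated_commutator C.

Let nM j : normal_subgroup (M j).
Proof.
by elim: j => // j IHj; apply: commutator_normal => //; apply: normalT.
Qed.

Let ML j : M j `<=` lower_central G j.+1.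
Proof.
elim: j => // j IHj; apply: commutator_subset => [|h g Mh _].
  by case: (lower_central_normal G j.+2).
by rewrite lower_centralS; apply: mem_commutator => //; apply: IHj.
Qed.

(** Induction on [b] from [CZ]: the three subgroups lemma moves one commutation with the group
    either onto [[~ x, c]], down the upper central series, or onto [x], down the lower one. *)
Let lower_central_M k b x c : (k + b < i)%N ->
  lower_central G (i + k).+1 x -> M b c ->
  upper_central G (i - (k + b).+1) [~ x, c].
Proof.
elim: b k x c => [|b IHb] k x c lt_i Lx Mc.
  by rewrite addn0 in lt_i *; apply: CZ.
apply: (normal_commC (sZ _)); move: Mc Lx.
apply: (three_subgroups (nZ _) (proj1 (lower_central_normal G _))
         (proj1 (nM b)) sT) => {}x {}c g Lx Mc _.
  have : upper_central G (i - (k + b).+1) [~ x, c] by apply: IHb => //; lia.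
  have -> : (i - (k + b).+1 = (i - (k + b.+1).+1).+1)%N by lia.
  by move/upper_centralSP; apply.
rewrite addnS -addSn in lt_i *; apply: IHb => //.
by rewrite addnS lower_centralS; apply: mem_commutator.
Qed.

(** A further commutator with [g] is moved onto [u] or [v], which raises [a] or [b] by one and
    lowers [r] by one, until [r = 0]. *)
Lemma iterated_commutator_comm r a b u v : (r + a + b = (2 * i).-1)%N ->
  (0 < i)%N -> M a u -> M b v -> upper_central G r [~ u, v].
Proof.
move=> + i0; elim: r a b u v => [|r IHr] a b u v def_r Ma Mb.
  (* Now [a + b = 2i - 1], so one of [a], [b] is at least [i], and [lower_central_M] applies through
     [ML]. *)
  wlog le_ia : a b u v Ma Mb def_r / (i <= a)%N.
    move=> WL; have [le_ia|lt_ai] := leqP i a; first exact: WL def_r le_ia.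
    by apply: (normal_commC (sZ _)); apply: (WL b a) => //; lia.
  have lt_i : (a - i + b < i)%N by lia.
  have := @lower_central_M (a - i) b u v lt_i.
  have -> : (i - (a - i + b).+1 = 0)%N by lia.
  by rewrite subnKC //; apply => //; apply: ML.
apply/upper_centralSP => g; have [nMa nMb] := (nM a, nM b).
have : commutator_subgroup (M a) (M b) [~ u, v] by apply: mem_commutator.
move=> Muv; apply: (three_subgroups (nZ r) sT (proj1 nMa) (proj1 nMb) _ _ Muv)
  => // h x y _ Mx My.
  apply: (IHr a.+1 b) => //; first by lia.
  by apply: (normal_commC (proj1 (nM a.+1))); apply: mem_commutator.
apply: (normal_commC (sZ _)); apply: (IHr a b.+1) => //; first by lia.
by apply: (normal_commC (proj1 (nM b.+1))); apply: mem_commutator.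
Qed.

Lemma iterated_commutator_finite_mod j : (0 < i)%N -> (j <= i)%N ->
  finite_mod C setT ->
  finite_mod (upper_central G i) (lower_central G i.+1) ->
  finite_mod (upper_central G (i + j)) (M (i - j)).
Proof.
move=> i0 + [l lP] fL; elim: j => [|j IHj] lt_ji.
  rewrite addn0 subn0; exact: finite_modS (@ML i) fL.
have {IHj} := IHj (ltnW lt_ji); set N := upper_central G (i + j).
rewrite -[(i - j)%N]prednK ?subn_gt0 // -subnS; set k := (i - j.+1)%N => fM.
have sM := proj1 (nM k).
(* The commutators of M_k with [t] lie in M_(k+1), which is finite modulo [N] by the previous
   stage. *)
have fH t : t \in l -> finite_mod [set c | M k c /\ N [~ c, t]] (M k).
  move=> _; apply: finite_mod_centralizer => //; first exact: nZ.
  by apply: finite_modS fM => _ [c Mc <-]; apply: mem_commutator.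
have sH t : t \in l -> is_subgroup [set c | M k c /\ N [~ c, t]].
  move=> _; apply: is_subgroupP => [|a b [Ma Na] [Mb Nb]].
    by split; [|rewrite comm1g]; apply: subgroup1 => //; apply: sZ.
  split; first exact: (subgroupF sM).
  by apply: (normal_commMl (nZ _)) => //; apply: (normal_commV (nZ _)).
apply: finite_modW (finite_mod_seq_cap sH fH) => c Hc.
rewrite addnS; apply/upper_centralSP => g.
have [t tl Ctg] := lP g I; have [Mc Nc] := Hc t tl.
(* The factor [t^-1 * g] lies in [C], which is M_0, and [M_k, M_0] <= Z_(i+j) because (i + j) + k =
   2i - 1. *)
rewrite -[g](mulVKg t); apply: (normal_commC (sZ _)).
apply: normal_commMl; [exact: nZ|exact: normal_commC|].
apply: (normal_commC (sZ _)); apply: (@iterated_commutator_comm _ k 0) => //.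
by rewrite /k; lia.
Qed.

End IteratedCommutator.

(** * Translation to finite index, and the conclusion *)

Lemma finite_index_finite_mod G (K H : set G) :
  is_subgroup H -> finite_index K H -> finite_mod H K.
Proof.
move=> sH /finite_seqP[l lP].
have [|l' [_ l'P]] := @fiber_representatives G _ l
   (fun C x => C = left_coset H x) K.
  move=> x Kx; exists (left_coset H x) => //.
  have : left_cosets K H (left_coset H x) by exists x.
  by rewrite lP.
exists l' => x /l'P[b bl [_ [-> Ebx]]]; exists b => //.
have : left_coset H x x by exists 1; rewrite ?mulg1 //; apply: subgroup1.
by rewrite -Ebx => -[h Hh <-]; rewrite /eqmod mulKg.
Qed.

Lemma finite_mod_finite_index G (K H : set G) :
  is_subgroup H -> finite_mod H K -> finite_index K H.
Proof.
move=> sH [l lP];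
apply: (@sub_finite_set _ _ [set left_coset H x | x in [set` l]]).
  move=> _ [x /lP[b bl Hbx] <-]; exists b => //.
  apply/seteqP; split=> _ [h Hh <-].
    exists ((b^-1 * x)^-1 * h); last by group_simp.
    by apply: (subgroupM sH) => //; apply: (subgroupV sH).
  exists (b^-1 * x * h); last by group_simp.
  exact: (subgroupM sH).
by apply: finite_image; apply: finite_seq.
Qed.

Theorem theoremA (i : nat) (G : groupType) :
  (1 <= i)%N ->
  finite_index (lower_central G i.+1)
               (lower_central G i.+1 `&` upper_central G i) ->
  finite_index [set: G] (upper_central G (2 * i)%N).
Proof.
move=> i0 fi; have nZ := upper_central_normal G.
have nL := lower_central_normal G.
have fL : finite_mod (upper_central G i) (lower_central G i.+1).
  have sI := proj1 (normalI (nL i.+1) (nZ i)).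
  by apply: finite_modW (finite_index_finite_mod sI fi) => x [].
pose D k := centralizer_mod (upper_central G (i - k.+1))
                            (lower_central G (i + k).+1).
(* A finite intersection, so that one normal subgroup of finite index serves every [k < i]. *)
pose C := [set c | forall k, k \in iota 0 i -> D k c].
have nD k : normal_subgroup (D k) by apply: centralizer_mod_normal.
have nC : normal_subgroup C.
  split; last by move=> c g Cc k /Cc; apply: (proj2 (nD k)).
  apply: is_subgroupP => [k _|a b Ca Cb k ki].
    exact: subgroup1 (proj1 (nD k)).
  by apply: (subgroupF (proj1 (nD k))); [apply: Ca|apply: Cb].
have CD k : (k < i)%N -> C `<=` D k.
  by move=> lt_ki c; apply; rewrite mem_iota.
have fC : finite_mod C setT.
  apply: finite_mod_seq_cap => k; first by case: (nD k).
  rewrite mem_iota => /andP[_ lt_ki].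
  (* Here [n] is [i + k], with Z_(i-k-1) for [N] and Z_(i-k) for [N']. *)
  apply: (finite_mod_centralizer_lower_central (nZ _) (nZ (i - k))).
    move=> x g; rewrite -[(i - k)%N]prednK ?subn_gt0 // -subnS.
    by move/upper_centralSP.
  exact: lower_upper_finite_mod (ltnW lt_ki) fL.
apply: (finite_mod_finite_index (proj1 (nZ _))).
(* As [C] has finite index, its finiteness modulo Z_(2i) suffices: this is the case [j = i], where
   M_0 is [C]. *)
apply: (finite_mod_trans fC); rewrite mul2n -addnn.
have := iterated_commutator_finite_mod nC CD i0 (leqnn i) fC fL.
by rewrite subnn.
Qed.
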